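(* Suppose $(A_d,G_d)$ is reachable and $(C,A_d)$ is observable. Suppose $A$ has exactly $r'$ Hurwitz-unstable eigenvalues, i.e. eigenvalues with nonnegative real part, counted with multiplicity. Let $r\in\{1,\dots,n-1\}$ satisfy $\mathrm{Re}\,\lambda_r(A)>\mathrm{Re}\,\lambda_{r+1}(A)$, let $\bar U\in\mathcal{U}$, and let $\tilde F\in\mathbb{R}^{r\times p}$ be the steady-state low-rank Kalman gain. Then $A_d(I_n-\bar U\tilde FC)$ is Schur stable if and only if $r\ge r'$.
   Context: Let $A\in\mathbb{R}^{n\times n}$ have eigenvalues $\lambda_1(A),\dots,\lambda_n(A)$, ordered so that $\mathrm{Re}\,\lambda_1(A)\ge\dots\ge\mathrm{Re}\,\lambda_n(A)$, with unit-norm (generalized) eigenvectors $\psi_i(A)$. Let $\mathrm{St}(r,n)=\{X\in\mathbb{R}^{n\times r}:X^{\top}X=I_r\}$ and $$\mathcal{U}=\{(\psi_1(A),\dots,\psi_r(A))K\in\mathrm{St}(r,n):K\in\mathbb{C}^{r\times r}\}.$$ These are the real orthonormal-column matrices whose column space is the $A$-invariant subspace spanned by $\psi_1(A),\dots,\psi_r(A)$; they are the stable equilibria of the Oja flow $\varepsilon\dot U=(I_n-UU^{\top})AU$, and satisfy $(I_n-\bar U\bar U^{\top})A\bar U=0$. Let $h>0$, $A_d=e^{Ah}$, $G\in\mathbb{R}^{n\times q}$ and $$G_d=\sqrt{\int_0^h e^{A\tau}GG^{\top}e^{A^{\top}\tau}d\tau}$$ (positive semidefinite square root). Let $C\in\mathbb{R}^{p\times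 n}$ and $H\in\mathbb{R}^{p\times p}$ with $\det H\neq0$, and set $M=HH^{\top}$. Define $A_{\bar U}=\bar U^{\top}A_d\bar U$, $G_{\bar U}=\bar U^{\top}G_d$ and $C_{\bar U}=C\bar U$. The steady-state low-rank Kalman gain is $$\tilde F=\tilde RC_{\bar U}^{\top}(C_{\bar U}\tilde RC_{\bar U}^{\top}+M)^{-1},$$ where $\tilde R\in\mathbb{R}^{r\times r}$ is the unique positive definite solution of $$\tilde R=A_{\bar U}(\tilde R-\tilde FC_{\bar U}\tilde R)A_{\bar U}^{\top}+G_{\bar U}G_{\bar U}^{\top}.$$ A triple $(A_d,G_d,C)$ is called reachable and observable when $(A_d,G_d)$ is reachable and $(C,A_d)$ is observable. A square matrix is Schur stable if all its eigenvalues have modulus $<1$. *)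

(* Defs.v *)
From HB Require Import structures.
From mathcomp Require Import all_boot all_order all_algebra.
From mathcomp Require Import all_classical all_reals all_analysis.
From mathcomp Require Import complex.
Set Implicit Arguments. Unset Strict Implicit. Unset Printing Implicit Defensive.
Import Order.TTheory GRing.Theory Num.Theory.
Import numFieldNormedType.Exports.
Local Open Scope ring_scope.
Local Open Scope classical_set_scope.

Section Defs.
Variable R : realType.

Definition expm (n : nat) (A : 'M[R]_n) (t : R) : 'M[R]_n :=
  \matrix_(i, j) limn (fun N : nat => \sum_(k < N) ((t ^+ k / k`!%:R) *: A ^+ k) i j : R).

Definition mx_integral (m n : nat) (a b : R) (f : R -> 'M[R]_(m, n)) : 'M[R]_(m, n) :=
  \matrix_(i, j) Rintegral (@lebesgue_measure R) `[a, b] (fun t => f t i j).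

Definition cplx_mx (m n : nat) (M : 'M[R]_(m, n)) : 'M[R[i]]_(m, n) :=
  map_mx (fun x => (x%:C)%C) M.

Definition psd (n : nat) (M : 'M[R]_n) : Prop :=
  M^T = M /\ forall x : 'cV[R]_n, 0 <= (x^T *m M *m x) 0 0.

Definition pd (n : nat) (M : 'M[R]_n) : Prop :=
  M^T = M /\ forall x : 'cV[R]_n, x != 0 -> 0 < (x^T *m M *m x) 0 0.

Definition reachable (n q : nat) (A : 'M[R]_n) (B : 'M[R]_(n, q)) : Prop :=
  \rank (\mxrow_(k < n) (A ^+ k *m B)) = n.

Definition observable (p n : nat) (C : 'M[R]_(p, n)) (A : 'M[R]_n) : Prop :=
  \rank (\mxcol_(k < n) (C *m A ^+ k)) = n.

Definition schur_stable (n : nat) (M : 'M[R]_n) : Prop :=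
  forall z : R[i], root (char_poly (cplx_mx M)) z -> `|z| < 1.

Definition eigen_seq (n : nat) (A : 'M[R]_n) (s : seq R[i]) : Prop :=
  char_poly (cplx_mx A) = \prod_(z <- s) ('X - z%:P).

Definition re_nonincreasing (s : seq R[i]) : Prop :=
  sorted (fun z w => complex.Re w <= complex.Re z) s.

(* complex span of the generalized eigenvectors psi_1..psi_r, as a row space
   (row vector v^T generalised eigenvector of A^T <-> column vector v of A) *)
Definition top_spectral_space (n : nat) (A : 'M[R]_n) (s : seq R[i]) (r : nat)
  : 'M[R[i]]_n :=
  (\sum_(k < r) kermx (((cplx_mx A)^T - (nth 0 s k)%:M) ^+ n))%MS.

Definition in_calU (n r : nat) (A : 'M[R]_n) (s : seq R[i]) (U : 'M[R]_(n, r)) : Prop :=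
  U^T *m U = 1%:M /\ ((cplx_mx U)^T == top_spectral_space A s r)%MS.

Definition lr_gain (r p : nat) (CU : 'M[R]_(p, r)) (M : 'M[R]_p) (Rt : 'M[R]_r)
  : 'M[R]_(r, p) :=
  Rt *m CU^T *m invmx (CU *m Rt *m CU^T + M).

Definition lr_dare (r q p : nat) (AU : 'M[R]_r) (GU : 'M[R]_(r, q))
  (CU : 'M[R]_(p, r)) (M : 'M[R]_p) (Rt : 'M[R]_r) : Prop :=
  Rt = AU *m (Rt - lr_gain CU M Rt *m CU *m Rt) *m AU^T + GU *m GU^T.

End Defs.

(* Main.v *)
(** Left-multiplying by rows that annihilate the columns of Ubar, the closed loop
    matrix Ad (1 - Ubar Ft C) acts as Ad, while Ubar intertwines it with the reduced
    closed loop K = AU (1 - Ft CU). Hence its eigenvalues are those of K together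
    with those of Ad on the annihilator, which are the exp (h lambda_k), k > r; the
    latter all have modulus < 1 iff r' <= r.

    K is always Schur stable: if y K = z y, the Joseph form of the Riccati equation
    gives (1 - |z|^2) y Rt y^* >= |y GU|^2, and y GU = y Ubar^T Gd vanishes only for
    y = 0 because Gd is invertible. Indeed the left kernel of Gd consists of the rows
    x with x exp(A t) G = 0 on [0, h]; it is invariant under Ad, so it is trivial by
    reachability. *)
Require Import Defs.
From HB Require Import structures.
From mathcomp Require Import all_boot all_order all_algebra.
From mathcomp Require Import all_classical all_reals all_analysis.
From mathcomp Require Import complex ring lra.
Set Implicit Arguments. Unset Strict Implicit. Unset Printing Implicit Defensive.
Import Order.TTheory GRing.Theory Num.Theory.
Import numFieldNormedType.Exports.
Local Open Scope ring_scope.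

(** * Matrix exponential *)

Section Expm.
Local Open Scope classical_set_scope.
Variable R : realType.

(** Comparison with [b] times the exponential series at [a * |t|]. *)
Lemma is_cvg_pseries_fact (f : R^nat) (a b t : R) :
  0 <= a -> (forall k, `|f k| <= b * a ^+ k) ->
  cvgn (pseries (fun k => f k / k`!%:R) t).
Proof.
move=> a0 fab.
have b0 : 0 <= b by have := fab 0%N; rewrite expr0 mulr1; apply: le_trans.
apply: normed_cvg.
apply: (@series_le_cvg _ _ (fun k => b * exp_coeff (a * `|t|) k)).
- by move=> k /=; exact: normr_ge0.
- by move=> k; rewrite mulr_ge0 ?exp_coeff_ge0 ?mulr_ge0.
- move=> k /=; rewrite !normrM normfV normr_nat normrX /exp_coeff /= exprMn.
  rewrite !mulrA mulrAC; rewrite ler_wpM2r ?invr_ge0 ?ler0n//.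
  by rewrite ler_wpM2r ?exprn_ge0 ?fab.
- have := is_cvg_seriesZ (k := b) (is_cvg_series_exp_coeff (a * `|t|)).
  by congr (cvgn (series _)).
Qed.

(** Formal differentiation shifts [f] by one index, which only multiplies the constant [b] by [a].
    So the series and its first two formal derivatives converge everywhere, and termwise
    differentiation applies. *)
Lemma is_derive_pseries_fact (f : R^nat) (a b t : R) :
  0 <= a -> (forall k, `|f k| <= b * a ^+ k) ->
  is_derive t (1 : R) (fun x => limn (pseries (fun k => f k / k`!%:R) x))
    (limn (pseries (fun k => f k.+1 / k`!%:R) t)).
Proof.
move=> a0 fab.
have dE (g : R^nat) : pseries_diffs (fun k => g k / k`!%:R) =
    (fun k => g k.+1 / k`!%:R).
  apply/funext => k; rewrite /pseries_diffs factS natrM invfM.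
  by rewrite mulrCA mulVKf// pnatr_eq0.
have fab1 k : `|f k.+1| <= b * a * a ^+ k by rewrite -mulrA -exprS.
have fab2 k : `|f k.+2| <= b * a * a * a ^+ k by rewrite -mulrA -exprS.
rewrite -dE; apply: (@pseries_snd_diffs _ _ (`|t| + 1)); rewrite ?dE.
- exact: is_cvg_pseries_fact fab.
- exact: is_cvg_pseries_fact fab1.
- by move: fab2; exact: is_cvg_pseries_fact.
- by rewrite [ltRHS]ger0_norm ?ltrDl ?ltr01// addr_ge0.
Qed.

Section Square.
Variable n : nat.
Implicit Types A B : 'M[R]_n.

Definition expm_psum A (t : R) N : 'M[R]_n :=
  \sum_(k < N) (t ^+ k / k`!%:R) *: A ^+ k.

(** Induction on [k]: the sum of the moduli of all entries dominates every row sum. The factor [1]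
    gives the shape [b * a ^+ k] used for power series. *)
Lemma mxpow_norm_bound A : exists2 a : R, 0 <= a &
  forall k i j, `|(A ^+ k) i j| <= 1 * a ^+ k.
Proof.
exists (\sum_i \sum_j `|A i j|); first by rewrite !sumr_ge0// => i _; rewrite sumr_ge0.
elim=> [|k IH] i j.
  by rewrite !expr0 mulr1 mxE; case: (_ == _); rewrite ?normr1 ?normr0.
rewrite !exprS mul1r -mulmxE mxE (le_trans (ler_norm_sum _ _ _))//.
rewrite [X in _ <= X * _](bigD1 i)//= mulrDl -[leLHS]addr0 lerD//.
  rewrite mulr_suml ler_sum// => l _; rewrite normrM ler_wpM2l//.
  by have := IH l j; rewrite mul1r.
by rewrite mulr_ge0 ?exprn_ge0// ?sumr_ge0// => l _; rewrite sumr_ge0.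
Qed.

Lemma expm_psumE A t i j :
  (fun N => expm_psum A t N i j) = pseries (fun k => (A ^+ k) i j / k`!%:R) t.
Proof.
apply/funext => N; rewrite /pseries /series /= big_mkord summxE.
by apply: eq_bigr => k _; rewrite mxE mulrC mulrAC mulrA.
Qed.

Lemma expmE A t i j :
  expm A t i j = limn (pseries (fun k => (A ^+ k) i j / k`!%:R) t).
Proof.
rewrite -expm_psumE mxE; congr (limn _); apply/funext => N.
by rewrite summxE.
Qed.

Lemma cvg_expm_psum A t i j : expm_psum A t N i j @[N --> \oo] --> expm A t i j.
Proof.
have [a a0 Aa] := mxpow_norm_bound A.
rewrite expmE expm_psumE; apply: is_cvg_pseries_fact a0 _ => k; exact: Aa.
Qed.

End Square.

Lemma cvg_mulmx (m n p : nat) (F : nat -> 'M[R]_(m, n)) (G : nat -> 'M[R]_(n, p))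
    (X : 'M[R]_(m, n)) (Y : 'M[R]_(n, p)) :
  (forall i j, F N i j @[N --> \oo] --> X i j) ->
  (forall i j, G N i j @[N --> \oo] --> Y i j) ->
  forall i j, (F N *m G N) i j @[N --> \oo] --> (X *m Y) i j.
Proof.
move=> FX GY i j; rewrite mxE.
under eq_fun do rewrite mxE.
apply: cvg_big => [|k _]; first exact: add_continuous.
exact: cvgM.
Qed.

(** The relation passes to powers, then to partial sums, then to the limit. [X] may be rectangular,
    so that exponentials can be carried across [Ubar] and across the real form of a complex row. *)
Lemma mulmx_expm (m n : nat) (X : 'M[R]_(m, n)) (A : 'M[R]_n) (B : 'M[R]_m) t :
  X *m A = B *m X -> X *m expm A t = expm B t *m X.
Proof.
move=> XA.
have XAk k : X *m A ^+ k = B ^+ k *m X.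
  elim: k => [|k IH]; first by rewrite !expr0 mulmx1 mul1mx.
  by rewrite !exprS -!mulmxE mulmxA XA -mulmxA IH mulmxA.
apply/matrixP => i j.
have cX (k l : nat) (Z : 'M[R]_(k, l)) a b : Z a b @[_ --> \oo] --> Z a b.
  exact: cvg_cst.
apply: (@cvg_unique _ _ ((X *m expm_psum A t N) i j @[N --> \oo])) => //.
  by apply: cvg_mulmx => // *; exact: cvg_expm_psum.
have -> : (fun N => (X *m expm_psum A t N) i j) =
    (fun N => (expm_psum B t N *m X) i j).
  apply/funext => N; congr (fun_of_matrix _ i j); rewrite mulmx_sumr mulmx_suml.
  by apply: eq_bigr => k _; rewrite -scalemxAr -scalemxAl XAk.
by apply: cvg_mulmx => // *; exact: cvg_expm_psum.
Qed.

Lemma expm_tr (n : nat) (A : 'M[R]_n) t : expm A^T t = (expm A t)^T.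
Proof.
apply/matrixP => i j; rewrite [RHS]mxE !expmE; congr (limn (pseries _ _)).
have trX k : A^T ^+ k = (A ^+ k)^T.
  elim: k => [|k IH]; first by rewrite !expr0 trmx1.
  by rewrite exprS exprSr -!mulmxE trmx_mul IH.
by apply/funext => k; rewrite trX mxE.
Qed.

Lemma expmZ (n : nat) (A : 'M[R]_n) s t : expm (s *: A) t = expm A (s * t).
Proof.
have ZX k : (s *: A) ^+ k = s ^+ k *: A ^+ k.
  elim: k => [|k IH]; first by rewrite !expr0 scale1r.
  by rewrite !exprS IH -!mulmxE -scalemxAl -scalemxAr scalerA.
apply/matrixP => i j; rewrite !expmE; congr (limn _).
apply/funext => N; rewrite /pseries /series /=; apply: eq_bigr => k _.
rewrite ZX mxE exprMn [LHS]mulrAC [RHS]mulrAC; congr (_ / _).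
by rewrite mulrAC mulrC.
Qed.

Lemma expm0 (n : nat) (A : 'M[R]_n) : expm A 0 = 1%:M.
Proof.
apply/matrixP => i j; rewrite expmE -expm_psumE; apply: cvg_lim => //.
(* The partial sum for [N = 0] is empty; from [N = 1] on it is constant, since [0 ^+ 0 = 1]. *)
rewrite -cvg_shiftS /=.
have -> : (fun N => expm_psum A 0 N.+1 i j) = (fun=> (1%:M : 'M[R]_n) i j).
  apply/funext => N; rewrite /expm_psum big_ord_recl big1 ?addr0.
    by rewrite !expr0 fact0 divr1 scale1r.
  by move=> k _; rewrite exprS !mul0r scale0r.
exact: cvg_cst.
Qed.

Definition mx_is_derive (m n : nat) (F : R -> 'M[R]_(m, n)) t (D : 'M[R]_(m, n)) :=
  forall i j, is_derive t (1 : R) (fun x => F x i j) (D i j).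

Lemma mx_is_deriveM (m n p : nat) (F : R -> 'M[R]_(m, n)) (G : R -> 'M[R]_(n, p))
    t X Y :
  mx_is_derive F t X -> mx_is_derive G t Y ->
  mx_is_derive (fun x => F x *m G x) t (X *m G t + F t *m Y).
Proof.
move=> FX GY i j.
have -> : (fun x => (F x *m G x) i j) =
    \sum_k ((fun x => F x i k) * (fun x => G x k j)).
  by apply/funext => x; rewrite mxE fct_sumE; apply: eq_bigr.
rewrite !mxE -big_split /=.
have -> : \sum_i0 (X i i0 * G t i0 j + F t i i0 * Y i0 j) =
   \sum_k (F t i k *: Y k j + G t k j *: X i k).
  by apply: eq_bigr => k _; rewrite addrC [X _ _ * _]mulrC.
by apply: is_derive_sum => k; apply: is_deriveM.
Qed.

Lemma mx_is_derive_expm (n : nat) (A : 'M[R]_n) t :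
  mx_is_derive (expm A) t (A *m expm A t).
Proof.
move=> i j; have [a a0 Aa] := mxpow_norm_bound A.
have -> : (fun x => expm A x i j) =
    (fun x => limn (pseries (fun k => (A ^+ k) i j / k`!%:R) x)).
  by apply/funext => x; rewrite expmE.
have := is_derive_pseries_fact t a0 (fun k => Aa k i j).
congr (is_derive _ _ _ _); apply: cvg_lim => //.
have -> : pseries (fun k => (A ^+ k.+1) i j / k`!%:R) t =
    (fun N => (A *m expm_psum A t N) i j).
  apply/funext => N; rewrite /pseries /series /= big_mkord mulmx_sumr summxE.
  apply: eq_bigr => k _; rewrite -scalemxAr mulmxE -exprS mxE.
  by rewrite mulrC mulrAC mulrA.
apply: cvg_mulmx => [*|*]; first exact: cvg_cst.
exact: cvg_expm_psum.
Qed.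

Lemma mx_derive0_cst (m n : nat) (F : R -> 'M[R]_(m, n)) :
  (forall t, mx_is_derive F t 0) -> forall s t, F s = F t.
Proof.
move=> dF s t; apply/matrixP => i j.
apply: (@is_derive_0_is_cst _ (fun x => F x i j)) => x.
by have := dF x i j; rewrite mxE.
Qed.

Lemma continuous_expm (n : nat) (A : 'M[R]_n) i j :
  continuous (fun t => expm A t i j).
Proof.
move=> t; apply: differentiable_continuous; apply/derivable1_diffP.
by case: (mx_is_derive_expm A t i j).
Qed.

Lemma expm_comm (n : nat) (A B : 'M[R]_n) t : A *m B = B *m A ->
  A *m expm B t = expm B t *m A.
Proof. exact: mulmx_expm. Qed.

Lemma expmNK (n : nat) (A : 'M[R]_n) t : expm A t *m expm (- A) t = 1%:M.
Proof.
have <- : expm A 0 *m expm (- A) 0 = 1%:M by rewrite !expm0 mulmx1.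
apply: (@mx_derive0_cst _ _ (fun t => expm A t *m expm (- A) t)) => {}t.
have := mx_is_deriveM (mx_is_derive_expm A t) (mx_is_derive_expm (- A) t).
congr (mx_is_derive _ _ _).
by rewrite (expm_comm _ (erefl (A *m A))) mulNmx mulmxN mulmxA subrr.
Qed.

(** The product of [expm A], [expm B] and [expm (- (A + B))] has zero derivative, so it keeps its
    value [1] from time 0; the last factor is then cancelled. *)
Lemma expmD_comm (n : nat) (A B : 'M[R]_n) t : A *m B = B *m A ->
  expm (A + B) t = expm A t *m expm B t.
Proof.
move=> AB.
suff H : expm A t *m expm B t *m expm (- (A + B)) t = 1%:M.
  have E := expmNK (- (A + B)) t; rewrite opprK in E.
  by rewrite -[RHS]mulmx1 -E mulmxA H mul1mx.
have <- : expm A 0 *m expm B 0 *m expm (- (A + B)) 0 = 1%:M.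
  by rewrite !expm0 !mulmx1.
apply: (@mx_derive0_cst _ _
  (fun t => expm A t *m expm B t *m expm (- (A + B)) t)) => {}t.
have := mx_is_deriveM (mx_is_deriveM (mx_is_derive_expm A t)
  (mx_is_derive_expm B t)) (mx_is_derive_expm (- (A + B)) t).
congr (mx_is_derive _ _ _).
have cA : A *m expm A t = expm A t *m A by exact: expm_comm.
have cB : B *m expm B t = expm B t *m B by exact: expm_comm.
have cAB : A *m expm B t = expm B t *m A by exact: expm_comm.
rewrite mulNmx mulmxN !mulmxA -mulmxBl.
rewrite -[expm A t *m expm B t *m (A + B)]mulmxA mulmxDr -cB -cAB mulmxDr !mulmxA -cA.
by rewrite subrr mul0mx.
Qed.

(** All terms are exponentials at time [1], of the commuting matrices [s *: A], [t *: A] and their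
    sum. *)
Lemma expmD (n : nat) (A : 'M[R]_n) s t : expm A (s + t) = expm A s *m expm A t.
Proof.
rewrite -[s + t]mulr1 -expmZ scalerDl expmD_comm ?expmZ ?mulr1//.
by rewrite -!scalemxAl -!scalemxAr scalerA [s * t]mulrC -scalerA.
Qed.

Lemma expm_natmul (n : nat) (A : 'M[R]_n) t k : expm A (t *+ k) = expm A t ^+ k.
Proof.
elim: k => [|k IH]; first by rewrite mulr0n expm0 expr0.
by rewrite mulrS expmD IH exprS mulmxE.
Qed.

Lemma expm_scalar (n : nat) (c t : R) : expm c%:M t = (expR (c * t))%:M :> 'M[R]_n.
Proof.
apply/matrixP => i j.
rewrite expmE [RHS]mxE -[X in _ = X *+ _]/(limn _).
have -> : pseries (fun k => ((c%:M : 'M[R]_n) ^+ k) i j / k`!%:R) t =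
    (fun N => series (exp_coeff (c * t)) N *+ (i == j)).
  apply/funext => N; rewrite /pseries /series /= -sumrMnl; apply: eq_bigr => k _.
  have -> : (c%:M : 'M[R]_n) ^+ k = (c ^+ k)%:M.
    elim: k => [|k IH]; first by rewrite !expr0.
    by rewrite exprS IH -mulmxE -scalar_mxM -exprS.
  rewrite mxE /exp_coeff /= exprMn; case: (i == j).
    by rewrite !mulr1n mulrAC.
  by rewrite !mulr0n !mul0r.
case: (i == j) => /=; first by under eq_fun do rewrite mulr1n.
by under eq_fun do rewrite mulr0n; rewrite lim_cst.
Qed.

End Expm.

(** * Integrals of continuous matrix functions *)

Section Integral.
Local Open Scope classical_set_scope.
Variable R : realType.
Notation mu := (@lebesgue_measure R).

Lemma continuous_itv_integrable (a b : R) (f : R -> R) : continuous f ->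
  mu.-integrable `[a, b] (EFin \o f).
Proof.
move=> cf; apply: continuous_compact_integrable; first exact: segment_compact.
exact: continuous_subspaceT.
Qed.

Lemma continuous_sumr (I : Type) (l : seq I) (f : I -> R -> R) :
  (forall i, continuous (f i)) -> continuous (fun t => \sum_(i <- l) f i t).
Proof.
move=> cf t; apply: cvg_big => [|i _]; [exact: add_continuous|exact: cf].
Qed.

Lemma Rintegral_sum (I : Type) (l : seq I) (f : I -> R -> R) (a b : R) :
  (forall i, continuous (f i)) ->
  Rintegral mu `[a, b] (fun t => \sum_(i <- l) f i t) =
  \sum_(i <- l) Rintegral mu `[a, b] (f i).
Proof.
move=> cf; elim: l => [|i l IH].
  rewrite big_nil; under eq_Rintegral do rewrite big_nil.
  by rewrite Rintegral_cst // mul0r.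
rewrite big_cons -IH; under eq_Rintegral do rewrite big_cons.
apply: RintegralD => //; first exact: continuous_itv_integrable.
by apply: continuous_itv_integrable; exact: continuous_sumr.
Qed.

(** A positive value [f t] would bound the integral below by [f t / 2] times a positive length. *)
Lemma Rintegral_eq0_continuous (a b : R) (f : R -> R) : a < b -> continuous f ->
  (forall t, 0 <= f t) -> Rintegral mu `[a, b] f = 0 ->
  forall t, a <= t <= b -> f t = 0.
Proof.
move=> ab cf f0 int0 t /andP[at_ tb]; apply/eqP; rewrite eq_le f0 andbT leNgt.
apply/negP => ft0.
have [d /= d0 fd] : exists2 d : R, 0 < d & forall u, `|t - u| < d -> f t / 2 < f u.
  have ft20 : 0 < f t / 2 by rewrite divr_gt0.
  have /cvgrPdist_lt/(_ _ ft20)/nbhs_ballP[d /= d0 fd] := cf t.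
  exists d => // u /fd /=.
  by rewrite ltr_distlC => /andP[+ _]; lra.
(* Clipping to [[a, b]] leaves a nondegenerate interval even when [t] is an endpoint; halving [d]
   keeps this closed interval inside the open ball. *)
pose a' := Num.max a (t - d / 2); pose b' := Num.min b (t + d / 2).
have ab' : a' < b'.
  by rewrite /a' /b' gt_max !lt_min; lra.
have sub : `[a', b'] `<=` `[a, b].
  by apply: subset_itv; rewrite bnd_simp /a' /b' ?le_max ?ge_min lexx.
have intf := continuous_itv_integrable a b cf.
have int0E : (\int[mu]_(x in `[a, b]) (f x)%:E = 0)%E.
  by rewrite -[LHS]fineK ?integrable_fin_num //; congr EFin.
have : ((f t / 2 * (b' - a'))%:E <= \int[mu]_(x in `[a, b]) (f x)%:E)%E.
  apply: (@le_trans _ _ (\int[mu]_(x in `[a', b']) (f x)%:E)%E); last first.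
    apply: ge0_subset_integral => //; first exact: measurable_int intf.
    by move=> x _; rewrite lee_fin.
  have <- : (\int[mu]_(x in `[a', b']) (f t / 2)%:E)%E = (f t / 2 * (b' - a'))%:E.
    rewrite integral_cst //= lebesgue_measure_itv /= lte_fin ab'.
    by rewrite -EFinB -EFinM.
  apply: ge0_le_integral => //=.
  - by move=> x _; rewrite lee_fin; lra.
  - exact: measurable_int (continuous_itv_integrable a' b' cf).
  - move=> x; rewrite in_itv /= => /andP[a'x xb']; rewrite lee_fin ltW // fd //.
    move: a'x xb'; rewrite /a' /b' ge_max le_min => /andP[_ ?] /andP[_ ?].
    by rewrite ltr_distlC; apply/andP; split; lra.
rewrite int0E lee_fin leNgt => /negP; apply; rewrite mulr_gt0 ?subr_gt0 //.
by rewrite divr_gt0.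
Qed.

Definition mx_continuous (m n : nat) (F : R -> 'M[R]_(m, n)) :=
  forall i j, continuous (fun t => F t i j).

Lemma mx_continuous_cst (m n : nat) (X : 'M[R]_(m, n)) : mx_continuous (fun=> X).
Proof. by move=> i j t; exact: cvg_cst. Qed.

Lemma mx_continuous_tr (m n : nat) (F : R -> 'M[R]_(m, n)) :
  mx_continuous F -> mx_continuous (fun t => (F t)^T).
Proof. by move=> cF i j; under eq_fun do rewrite mxE; exact: cF. Qed.

Lemma mx_continuousM (m n p : nat) (F : R -> 'M[R]_(m, n)) (G : R -> 'M[R]_(n, p)) :
  mx_continuous F -> mx_continuous G -> mx_continuous (fun t => F t *m G t).
Proof.
move=> cF cG i j.
rewrite (_ : (fun t => _) = fun t => \sum_k F t i k * G t k j); last first.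
  by apply/funext => t; rewrite mxE.
by apply: continuous_sumr => k t; apply: cvgM; [exact: cF|exact: cG].
Qed.

Lemma mx_integral_qf (n : nat) (a b : R) (F : R -> 'M[R]_n) (x : 'rV[R]_n) :
  mx_continuous F ->
  (x *m mx_integral a b F *m x^T) 0 0 =
  Rintegral mu `[a, b] (fun t => (x *m F t *m x^T) 0 0).
Proof.
move=> cF.
have qfE (X : 'M[R]_n) : (x *m X *m x^T) 0 0 =
    \sum_i \sum_j (x 0 j * x 0 i) * X j i.
  rewrite mxE; apply: eq_bigr => i _; rewrite !mxE mulr_suml.
  by apply: eq_bigr => j _; rewrite mulrAC.
have cxF i j : continuous (fun t => (x 0 j * x 0 i) * F t j i).
  by move=> t; apply: cvgM; [exact: cvg_cst|exact: cF].
rewrite qfE; under eq_Rintegral do rewrite qfE.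
rewrite Rintegral_sum => [|i]; last by apply: continuous_sumr => j; exact: cxF.
apply: eq_bigr => i _; rewrite Rintegral_sum //; apply: eq_bigr => j _.
by rewrite mxE RintegralZl //; exact: continuous_itv_integrable.
Qed.

End Integral.

(** * Complex rows as real matrices, and the Riccati equation *)

Section Realification.
Variable R : realType.

(* The complex row u + i v is stored as the real matrix with rows u and v; scaling
   by a complex number is then left multiplication by a conformal matrix. *)
Definition reim n (x : 'rV[R[i]]_n) : 'M[R]_(2, n) :=
  \matrix_(k, j) if k == 0 then complex.Re (x 0 j) else complex.Im (x 0 j).

Definition conf_mx (z : R[i]) : 'M[R]_2 :=
  \matrix_(k, j) if k == j then complex.Re z
                 else if k == 0 then - complex.Im z else complex.Im z.

Definition sqmod (z : R[i]) : R := complex.Re z ^+ 2 + complex.Im z ^+ 2.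

Lemma cplx_mxM m n p (X : 'M[R]_(m, n)) (Y : 'M[R]_(n, p)) :
  cplx_mx (X *m Y) = cplx_mx X *m cplx_mx Y.
Proof. exact: (map_mxM (real_complex R)). Qed.

Lemma cplx_mxB m n (X Y : 'M[R]_(m, n)) : cplx_mx (X - Y) = cplx_mx X - cplx_mx Y.
Proof. exact: (map_mxB (real_complex R)). Qed.

Lemma reim_mul n p (x : 'rV[R[i]]_n) (A : 'M[R]_(n, p)) :
  reim (x *m cplx_mx A) = reim x *m A.
Proof.
apply/matrixP => k j; rewrite !mxE.
case: ifPn => k0; rewrite raddf_sum /=; apply: eq_bigr => l _;
  rewrite !mxE ?k0 ?(negPf k0); case: (x 0 l) => a b /=; ring.
Qed.

Lemma reim_scale n z (x : 'rV[R[i]]_n) : reim (z *: x) = conf_mx z *m reim x.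
Proof.
apply/matrixP => k j; rewrite !mxE big_ord_recl big_ord1 !mxE.
have [->|->] : k = 0 \/ k = 1.
- by case: k => [[|[|//]]] lt; [left|right]; apply: val_inj.
- by case: z => a b; case: (x 0 j) => c d /=; ring.
- by case: z => a b; case: (x 0 j) => c d /=; ring.
Qed.

Lemma reim_eq0 n (x : 'rV[R[i]]_n) : (reim x == 0) = (x == 0).
Proof.
apply/eqP/eqP => [x0|->]; last first.
  by apply/matrixP => k j; rewrite !mxE; case: ifP.
apply/rowP => j; have /matrixP xE := x0.
have := xE 0 j; have := xE 1 j; rewrite !mxE /=.
by case: (x 0 j) => a b /= -> ->.
Qed.

Lemma conf_mx_gram z : (conf_mx z)^T *m conf_mx z = (sqmod z)%:M.
Proof.
apply/matrixP => k j; rewrite !mxE big_ord_recl big_ord1 !mxE /sqmod.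
case: k => [[|[|//]]] ?; case: j => [[|[|//]]] ? /=;
  rewrite ?mulr1n ?mulr0n; ring.
Qed.

Lemma norm_lt1_sqmod (z : R[i]) : (`|z| < 1) = (sqmod z < 1).
Proof.
case: z => a b; rewrite normc_def /= (ltcR _ 1) /sqmod /=.
have s0 : 0 <= a ^+ 2 + b ^+ 2 by rewrite addr_ge0 ?sqr_ge0.
by rewrite -[in RHS](sqr_sqrtr s0) expr_lt1 ?sqrtr_ge0.
Qed.

(** Conformal matrices are the commutant of [conf_mx 'i], so the exponential [E] is again conformal.
    Its squared modulus is read off from [E^T *m E], the exponential of the scalar matrix
    [2 * Re mu]. *)
Lemma expm_conf_mx (mu : R[i]) h : exists2 z, expm (conf_mx mu) h = conf_mx z &
  sqmod z = expR (2 * complex.Re mu * h).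
Proof.
set E := expm _ _.
have conf_comm : conf_mx 'i *m conf_mx mu = conf_mx mu *m conf_mx 'i.
  apply/matrixP => k j; rewrite !mxE !big_ord_recl !big_ord0 !mxE.
  by case: k => [[|[|//]]] ?; case: j => [[|[|//]]] ? /=; ring.
have iE : conf_mx 'i *m E = E *m conf_mx 'i by exact: mulmx_expm.
have EE : E = conf_mx (E 0 0 +i* E 1 0)%C.
  apply/matrixP => k j; rewrite mxE /=.
  (* These two entries give [E 0 1 = - E 1 0] and [E 0 0 = E 1 1]. *)
  have /matrixP iEE := iE; have := iEE 0 0; have := iEE 0 1.
  rewrite !mxE !big_ord_recl !big_ord0 !mxE /=.
  have l0 : lift 0 0 = 1 :> 'I_2 by apply: val_inj.
  have -> : k = if k == 0 then 0 else 1 by case: k => [[|[|//]]] ?; apply: val_inj.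
  have -> : j = if j == 0 then 0 else 1 by case: j => [[|[|//]]] ?; apply: val_inj.
  by case: ifP => _; case: ifP => _ /=; rewrite ?l0; lra.
exists (E 0 0 +i* E 1 0)%C => //.
have : (conf_mx (E 0 0 +i* E 1 0)%C)^T *m conf_mx (E 0 0 +i* E 1 0)%C =
    (expR (2 * complex.Re mu * h))%:M.
  rewrite -EE -expm_tr -expm_scalar -expmD_comm.
    congr (expm _ h); apply/matrixP => k j; rewrite !mxE.
    by case: k => [[|[|//]]] ?; case: j => [[|[|//]]] ? /=;
      rewrite ?mulr1n ?mulr0n; ring.
  apply/matrixP => k j; rewrite !mxE !big_ord_recl !big_ord0 !mxE.
  by case: k => [[|[|//]]] ?; case: j => [[|[|//]]] ? /=; ring.
by rewrite conf_mx_gram => /matrixP/(_ 0 0); rewrite !mxE.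
Qed.

(** In real form the eigenvalue equation says that [reim x] intertwines [A] with [conf_mx mu], hence
    also their exponentials. *)
Lemma eigenrow_expm n (A : 'M[R]_n) (x : 'rV[R[i]]_n) mu h :
  x *m cplx_mx A = mu *: x ->
  exists2 z, x *m cplx_mx (expm A h) = z *: x &
    sqmod z = expR (2 * complex.Re mu * h).
Proof.
move=> xA; have [z Ez zE] := expm_conf_mx mu h; exists z => //.
apply/eqP; rewrite -subr_eq0 -reim_eq0.
have reimB (u v : 'rV[R[i]]_n) : reim (u - v) = reim u - reim v.
  by apply/matrixP => k j; rewrite !mxE; case: ifP; case: (u 0 j); case: (v 0 j).
rewrite reimB reim_mul reim_scale -Ez subr_eq0; apply/eqP.
by apply: mulmx_expm; rewrite -reim_mul -reim_scale xA.
Qed.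

Lemma schur_stableP n (M : 'M[R]_n) : schur_stable M <->
  forall z (x : 'rV[R[i]]_n), x != 0 -> x *m cplx_mx M = z *: x -> sqmod z < 1.
Proof.
split=> [S z x x0 xM | S z].
  rewrite -norm_lt1_sqmod; apply: S; rewrite -eigenvalue_root_char.
  by apply/eigenvalueP; exists x.
rewrite -eigenvalue_root_char norm_lt1_sqmod => /eigenvalueP[x xM x0].
exact: S xM.
Qed.

(** * Trace positivity and stability of the reduced filter *)

Lemma gram_trace_ge0 m n (Y : 'M[R]_(m, n)) : 0 <= \tr (Y *m Y^T).
Proof.
rewrite sumr_ge0// => i _; rewrite mxE sumr_ge0// => j _.
by rewrite mxE -expr2 sqr_ge0.
Qed.

Lemma gram_trace_eq0 m n (Y : 'M[R]_(m, n)) : \tr (Y *m Y^T) = 0 -> Y = 0.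
Proof.
move=> /eqP; rewrite psumr_eq0 => [/allP Y0|i _]; last first.
  by rewrite mxE sumr_ge0// => j _; rewrite mxE -expr2 sqr_ge0.
apply/matrixP => i j; have := Y0 i (mem_index_enum _).
rewrite mxE psumr_eq0 => [/allP/(_ j (mem_index_enum _))|k _]; last first.
  by rewrite mxE -expr2 sqr_ge0.
by rewrite !mxE -expr2 sqrf_eq0 => /eqP.
Qed.

(** The trace sums the quadratic form of [P] over the rows of [Y]. For [Y = reim x] it is the
    Hermitian form of [P] at the complex row [x]. *)
Lemma pd_trace_gt0 m n (P : 'M[R]_n) (Y : 'M[R]_(m, n)) :
  pd P -> Y != 0 -> 0 < \tr (Y *m P *m Y^T).
Proof.
move=> [_ Ppos] Y0.
have trE : \tr (Y *m P *m Y^T) = \sum_i (((row i Y)^T)^T *m P *m (row i Y)^T) 0 0.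
  apply: eq_bigr => i _; rewrite trmxK -row_mul [LHS]mxE [RHS]mxE.
  by apply: eq_bigr => j _; rewrite !mxE.
have pos i : row i Y != 0 -> 0 < (((row i Y)^T)^T *m P *m (row i Y)^T) 0 0.
  by move=> Yi0; apply: Ppos; rewrite trmx_eq0.
have nneg i : 0 <= (((row i Y)^T)^T *m P *m (row i Y)^T) 0 0.
  have [Yi0|/pos/ltW//] := eqVneq (row i Y) 0.
  by rewrite Yi0 !trmx0 !mul0mx mxE.
have [i Yi0] : exists i, row i Y != 0.
  apply/existsP; apply: contraR Y0; rewrite negb_exists => /forallP Y0.
  by apply/eqP/row_matrixP => i; rewrite row0; apply/eqP; rewrite -[_ == _]negbK Y0.
by rewrite trE (bigD1 i)//= ltr_pwDl ?pos// sumr_ge0.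
Qed.

Lemma pd_trace_ge0 m n (P : 'M[R]_n) (Y : 'M[R]_(m, n)) :
  pd P -> 0 <= \tr (Y *m P *m Y^T).
Proof.
have [->|Y0 /pd_trace_gt0/(_ Y0)/ltW//] := eqVneq Y 0.
by rewrite !mul0mx mxtrace0.
Qed.

(** On the left kernel [K], a sum of two nonnegative traces vanishes; hence [K *m H = 0], and [H] is
    invertible. *)
Lemma innovation_unit r p (CU : 'M[R]_(p, r)) (H : 'M[R]_p) (P : 'M[R]_r) :
  \det H != 0 -> pd P -> CU *m P *m CU^T + H *m H^T \in unitmx.
Proof.
move=> detH Ppd; rewrite -row_free_unit -kermx_eq0; apply/eqP.
set K := kermx _.
have K0 : K *m (CU *m P *m CU^T + H *m H^T) = 0 by rewrite mulmx_ker.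
have : \tr (K *m (CU *m P *m CU^T + H *m H^T) *m K^T) = 0.
  by rewrite K0 mul0mx mxtrace0.
have -> : K *m (CU *m P *m CU^T + H *m H^T) *m K^T =
   (K *m CU) *m P *m (K *m CU)^T + (K *m H) *m (K *m H)^T.
  by rewrite !trmx_mul mulmxDr mulmxDl !mulmxA.
move=> /eqP; rewrite mxtraceD paddr_eq0 ?pd_trace_ge0 ?gram_trace_ge0//.
move=> /andP[_ /eqP/gram_trace_eq0 KH].
have Hu : H \in unitmx by rewrite unitmxE unitfE.
by rewrite -[LHS](mulmxK Hu) KH mul0mx.
Qed.

(* Joseph form: the Riccati update is a congruence plus two Gram matrices. *)
Lemma lr_dare_joseph r q p (AU : 'M[R]_r) (GU : 'M[R]_(r, q))
    (CU : 'M[R]_(p, r)) (H : 'M[R]_p) (P : 'M[R]_r) :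
  \det H != 0 -> pd P -> lr_dare AU GU CU (H *m H^T) P ->
  let F := lr_gain CU (H *m H^T) P in
  let K := AU *m (1%:M - F *m CU) in
  P = K *m P *m K^T + (AU *m F *m H) *m (AU *m F *m H)^T + GU *m GU^T.
Proof.
move=> detH Ppd dare F K; rewrite [LHS]dare -/F; congr (_ + _).
have Psym : P^T = P by case: Ppd.
set S := CU *m P *m CU^T + H *m H^T.
have FS : F *m S = P *m CU^T by rewrite /F /lr_gain mulmxKV ?innovation_unit.
(* The terms quadratic in [F] of the expanded Joseph form thus cancel one of its two cross terms. *)
have FSF : F *m CU *m P *m CU^T *m F^T + F *m H *m H^T *m F^T = P *m CU^T *m F^T.
  by rewrite -FS /S mulmxDr mulmxDl !mulmxA.
have congrE (W : 'M[R]_r) (F0 : 'M[R]_(r, p)) :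
    AU *m W *m P *m (AU *m W)^T + AU *m F0 *m H *m (AU *m F0 *m H)^T =
    AU *m (W *m P *m W^T + F0 *m H *m H^T *m F0^T) *m AU^T.
  by rewrite !trmx_mul mulmxDr mulmxDl !mulmxA.
rewrite congrE {congrE K}; congr (_ *m _ *m _); clearbody F.
rewrite linearB /= trmx1 trmx_mul mulmxBr mulmx1 mulmxBl mul1mx mulmxBl !mulmxA.
by rewrite -FSF [X in _ - (X - _)]addrC addrK subrK.
Qed.

Lemma lr_closed_loop_schur r q p (AU : 'M[R]_r) (GU : 'M[R]_(r, q))
    (CU : 'M[R]_(p, r)) (H : 'M[R]_p) (P : 'M[R]_r) :
  \det H != 0 -> pd P -> lr_dare AU GU CU (H *m H^T) P -> row_free GU ->
  schur_stable (AU *m (1%:M - lr_gain CU (H *m H^T) P *m CU)).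
Proof.
move=> detH Ppd dare GUfree; apply/schur_stableP => z x x0.
have := lr_dare_joseph detH Ppd dare; cbv zeta.
set K := AU *m _; set L := AU *m _ *m H => PE xK; clearbody K L.
set Y := reim x; have Y0 : Y != 0 by rewrite reim_eq0.
have YK : Y *m K = conf_mx z *m Y by rewrite -reim_mul xK reim_scale.
have Ppos := pd_trace_gt0 Ppd Y0.
(* The Joseph form evaluated at [Y]: cyclicity of the trace brings [(conf_mx z)^T] next to
   [conf_mx z], which produces the factor [sqmod z]. *)
have E : \tr (Y *m P *m Y^T) = sqmod z * \tr (Y *m P *m Y^T) +
    \tr (Y *m L *m (Y *m L)^T) + \tr (Y *m GU *m (Y *m GU)^T).
  rewrite {1}PE !mulmxDr !mulmxDl !mxtraceD; congr (_ + _ + _).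
  - have -> : Y *m (K *m P *m K^T) *m Y^T =
        conf_mx z *m (Y *m P *m Y^T *m (conf_mx z)^T).
      rewrite !mulmxA YK -[_ *m K^T *m _]mulmxA -trmx_mul YK trmx_mul.
      by rewrite !mulmxA.
    rewrite [LHS]mxtrace_mulC -[X in \tr X]mulmxA conf_mx_gram.
    by rewrite mul_mx_scalar mxtraceZ.
  - by rewrite trmx_mul !mulmxA.
  - by rewrite trmx_mul !mulmxA.
rewrite ltNge; apply/negP => z1.
(* With [1 <= sqmod z], the identity [E] leaves no room for a positive Gram trace. *)
have G0 : \tr (Y *m GU *m (Y *m GU)^T) = 0.
  apply/eqP; rewrite eq_le gram_trace_ge0 andbT.
  have L0 := gram_trace_ge0 (Y *m L); nra.
move/gram_trace_eq0: G0 => /eqP; rewrite mulmx_free_eq0 // => /eqP Y00.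
by rewrite Y00 eqxx in Y0.
Qed.
End Realification.

(** * Generalized eigenspaces *)

Section Spectral.
Variables (F : fieldType) (n : nat).
Implicit Types (f : 'M[F]_n) (y : 'cV[F]_n).

Lemma mulmx_pow_eigen f lam mu y k : f *m y = mu *: y ->
  (f - lam%:M) ^+ k *m y = (mu - lam) ^+ k *: y.
Proof.
move=> fy; elim: k => [|k IH]; first by rewrite !expr0 mul1mx scale1r.
rewrite exprSr -mulmxE -mulmxA mulmxBl fy mul_scalar_mx -scalerBl -scalemxAr IH.
by rewrite scalerA exprS.
Qed.

(** The matrix [(f - lam%:M) ^+ k] scales [y] by the nonzero number [(mu - lam) ^+ k], while the
    kernel rows annihilate that matrix. *)
Lemma kermx_pow_orth f lam mu y k : f *m y = mu *: y -> mu != lam ->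
  kermx ((f - lam%:M) ^+ k) *m y = 0.
Proof.
move=> fy neq; have /(congr1 (mulmxr y)) := mulmx_ker ((f - lam%:M) ^+ k).
rewrite /= mul0mx -mulmxA (mulmx_pow_eigen _ _ fy) -scalemxAr => /eqP.
by rewrite scalemx_eq0 expf_eq0 subr_eq0 (negPf neq) andbF => /eqP.
Qed.

End Spectral.

Lemma horner_mx_eigen (F : fieldType) n (f : 'M[F]_n.+1) mu (y : 'cV[F]_n.+1) p :
  f *m y = mu *: y -> horner_mx f p *m y = p.[mu] *: y.
Proof.
move=> fy; elim/poly_ind: p => [|p c IH].
  by rewrite rmorph0 mul0mx horner0 scale0r.
rewrite rmorphD rmorphM /= horner_mx_X horner_mx_C mulmxDl -mulmxE -mulmxA fy.
by rewrite -scalemxAr IH mul_scalar_mx scalerA -scalerDl !hornerE mulrC.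
Qed.

(* With char_poly f = (X - mu)^m q and q(mu) <> 0, the two kernels span the space,
   and y is orthogonal to both. *)
Lemma kermx_pow_orth_eq0 (F : fieldType) n (f : 'M[F]_n) s mu (y : 'cV[F]_n) :
  char_poly f = \prod_(z <- s) ('X - z%:P) -> f *m y = mu *: y ->
  kermx ((f - mu%:M) ^+ n) *m y = 0 -> y = 0.
Proof.
case: n f y => [|n] f y charE fy kery; first by rewrite [y]flatmx0.
pose m := count_mem mu s.
have sz : size s = n.+1.
  by have := size_char_poly f; rewrite charE size_prod_XsubC => -[].
pose q := \prod_(z <- s | z != mu) ('X - z%:P) : {poly F}.
have charE' : char_poly f = ('X - mu%:P) ^+ m * q.
  rewrite charE (bigID (pred1 mu)) /=; congr (_ * _).
  rewrite -big_filter (eq_big_seq (fun=> 'X - mu%:P)) => [|z]; last first.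
    by rewrite mem_filter /= => /andP[/eqP-> _].
  by rewrite big_const_seq count_predT size_filter iter_mulr_1.
have qmu : ~~ root q mu.
  by rewrite /q -big_filter root_prod_XsubC mem_filter eqxx.
have cop : coprimep (('X - mu%:P) ^+ m) q.
  by apply: coprimep_expl; rewrite coprimep_sym coprimep_XsubC.
(* By Cayley-Hamilton this kernel is everything; coprimality then splits it into the kernels of the
   two factors. *)
have full : (1%:M <= kermxpoly f (char_poly f))%MS.
  by rewrite /kermxpoly Cayley_Hamilton; apply/sub_kermxP; rewrite mulmx0.
suff : (1%:M <= kermx y)%MS by move/sub_kermxP; rewrite mul1mx.
apply: submx_trans full _; rewrite charE' kermxpolyM // addsmx_sub; apply/andP; split.
  have : (kermx ((f - mu%:M) ^+ n.+1) <= kermx y)%MS by apply/sub_kermxP.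
  apply: submx_trans; apply/sub_kermxP.
  have le : (m <= n.+1)%N by rewrite -sz count_size.
  have -> : (f - mu%:M) ^+ n.+1 = (f - mu%:M) ^+ m *m (f - mu%:M) ^+ (n.+1 - m).
    by rewrite mulmxE -exprD subnKC.
  rewrite mulmxA; have -> : (f - mu%:M) ^+ m = horner_mx f (('X - mu%:P) ^+ m).
    by rewrite rmorphXn rmorphB /= horner_mx_X horner_mx_C.
  by rewrite mulmx_ker mul0mx.
apply/sub_kermxP.
have /(congr1 (mulmxr y)) := mulmx_ker (horner_mx f q).
rewrite /= mul0mx -mulmxA (horner_mx_eigen _ fy) -scalemxAr => /eqP.
by rewrite scalemx_eq0 -rootE (negPf qmu) => /eqP.
Qed.

(** The matrix [D] of [f] restricted to [E], in the basis [row_base E], has positive size and so an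
    eigenvalue over a closed field. *)
Lemma stablemx_eigenrow (C : numClosedFieldType) n (E f : 'M[C]_n) :
  E != 0 -> stablemx E f ->
  exists v a, [/\ v != 0, (v <= E)%MS & v *m f = a *: v :> 'rV[C]_n].
Proof.
move=> E0 stE.
have /submxP[D DE] : (row_base E *m f <= row_base E)%MS.
  by rewrite eq_row_base (submx_trans _ stE) // submxMr // eq_row_base.
have [a /eigenvalueP[w wD w0]] : exists a, eigenvalue D a.
  by apply: eigenvalue_closed; rewrite lt0n mxrank_eq0.
exists (w *m row_base E), a; split.
- by rewrite mulmx_free_eq0 ?row_base_free.
- by rewrite mulmx_sub // eq_row_base.
- by rewrite -mulmxA DE mulmxA wD scalemxAl.
Qed.

Lemma char_poly_trmx (F : comNzRingType) n (f : 'M[F]_n) :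
  char_poly f^T = char_poly f.
Proof.
rewrite /char_poly -[RHS]det_tr; congr (\det _).
by rewrite /char_poly_mx linearB /= tr_scalar_mx map_trmx.
Qed.

(** * The ordered spectrum and the dominant invariant subspace *)

Section TopSpace.
Variable R : realType.

Lemma re_nonincreasing_nth (s : seq R[i]) j k : re_nonincreasing s ->
  (j <= k < size s)%N -> complex.Re (nth 0 s k) <= complex.Re (nth 0 s j).
Proof.
move=> sorted_s /andP[jk ks].
apply: (sorted_leq_nth _ _ 0 sorted_s) => //; last by rewrite inE (leq_ltn_trans jk).
by move=> y x z xy yz; exact: le_trans yz xy.
Qed.

(** By monotonicity the entries with nonnegative real part form a prefix of [s], whose length is the
    count. *)
Lemma count_Re_ge0 (s : seq R[i]) k : re_nonincreasing s -> (k < size s)%N ->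
  (0 <= complex.Re (nth 0 s k)) = (k < count (fun z => (0 <= complex.Re z)%R) s)%N.
Proof.
move=> sorted_s ks; apply/idP/idP => [k0|].
  rewrite -[s in count _ s](cat_take_drop k.+1) count_cat.
  apply: leq_trans (leq_addr _ _).
  have : all (fun z => (0 <= complex.Re z)%R) (take k.+1 s).
    apply/(all_nthP 0) => j; rewrite size_take_min leq_min => /andP[jk _].
    rewrite nth_take //; apply: le_trans k0 _.
    by apply: re_nonincreasing_nth => //; rewrite -ltnS jk.
  by rewrite all_count => /eqP->; rewrite size_takel.
apply: contraTT; rewrite -ltNge => k0; rewrite -leqNgt.
rewrite -[s in count _ s](cat_take_drop k) count_cat.
rewrite [X in (_ + X)%N](_ : _ = 0%N) ?addn0.
  by apply: leq_trans (count_size _ _) _; rewrite size_takel // ltnW.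
apply/eqP; rewrite -leqn0 leqNgt -has_count; apply/hasPn => z /(nthP 0)[j].
rewrite size_drop ltn_subRL nth_drop => js <-; rewrite -ltNge.
by apply: le_lt_trans k0; apply: re_nonincreasing_nth => //; rewrite leq_addr.
Qed.

Variables (n r : nat) (A : 'M[R]_n) (s : seq R[i]) (U : 'M[R]_(n, r)).
Hypothesis Uc : in_calU A s U.

Lemma tr_eigenrow (x : 'rV[R[i]]_n) mu : x *m cplx_mx A = mu *: x ->
  (cplx_mx A)^T *m x^T = mu *: x^T.
Proof. by move=> xA; rewrite -trmx_mul xA linearZ. Qed.

Lemma calU_orthP (x : 'rV[R[i]]_n) :
  x *m cplx_mx U = 0 <-> forall k : 'I_r,
    kermx (((cplx_mx A)^T - (nth 0 s k)%:M) ^+ n) *m x^T = 0.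
Proof.
have [_ /eqmxP UT] := Uc.
have UxP : x *m cplx_mx U = 0 <-> (top_spectral_space A s r <= kermx x^T)%MS.
  rewrite -UT; split=> [xU|/sub_kermxP Ux].
    by apply/sub_kermxP; rewrite -trmx_mul xU trmx0.
  by apply: trmx_inj; rewrite trmx_mul Ux trmx0.
rewrite UxP; split=> [/sumsmx_subP kx k|kx].
  by apply/sub_kermxP/kx.
by apply/sumsmx_subP => k _; apply/sub_kermxP.
Qed.

Lemma calU_eigenrow_orth (x : 'rV[R[i]]_n) mu : x *m cplx_mx A = mu *: x ->
  (forall k, (k < r)%N -> mu != nth 0 s k) -> x *m cplx_mx U = 0.
Proof.
move=> /tr_eigenrow Ax neq; apply/calU_orthP => k.
by apply: kermx_pow_orth Ax (neq _ _).
Qed.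

Lemma calU_orth_eigenvalue (x : 'rV[R[i]]_n) mu : eigen_seq A s ->
  x != 0 -> x *m cplx_mx A = mu *: x -> x *m cplx_mx U = 0 ->
  forall k, (k < r)%N -> mu != nth 0 s k.
Proof.
move=> As x0 /tr_eigenrow Ax /calU_orthP xU k kr.
apply: contraNneq x0 => muE; rewrite -trmx_eq0; apply/eqP.
apply: kermx_pow_orth_eq0 Ax _; first by rewrite char_poly_trmx; exact: As.
by rewrite muE; exact: (xU (Ordinal kr)).
Qed.

(** Kernels of polynomials in the transposed matrix are stable under it, and so is their sum. The
    complex inclusion of row spaces descends to the real matrices, which yields a real [D]. *)
Lemma calU_invariant : exists D, A *m U = U *m D.
Proof.
have [_ /eqmxP UT] := Uc.
have : (U^T *m A^T <= U^T)%MS.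
  rewrite -(map_submx (real_complex R)) map_mxM -!map_trmx.
  change (((cplx_mx U)^T *m (cplx_mx A)^T <= (cplx_mx U)^T)%MS).
  rewrite (submx_trans (submxMr _ (_ : _ <= top_spectral_space A s r)%MS)) ?UT //.
  apply: stablemx_sums => k; apply: comm_mx_stable_ker.
  rewrite /comm_mx mulmxE; apply/commr_sym/commrX; apply: commrB => //.
  by rewrite /GRing.comm -mulmxE scalar_mxC.
by move=> /submxP[D DE]; exists D^T; apply: trmx_inj; rewrite !trmx_mul DE trmxK.
Qed.

End TopSpace.

(** * Reachability Gramian *)

(** By Cayley-Hamilton, [B ^+ k] is the remainder of ['X^k] modulo [char_poly B] evaluated at [B], a
    combination of powers below [n]. *)
Lemma mulmx_pow_eq0 (F : fieldType) m n q (x : 'M[F]_(m, n)) (B : 'M[F]_n)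
    (G : 'M[F]_(n, q)) :
  (forall k, (k < n)%N -> x *m B ^+ k *m G = 0) ->
  forall k, x *m B ^+ k *m G = 0.
Proof.
case: n x B G => [|n] x B G xBG k; first by rewrite [G]flatmx0 mulmx0.
have -> : B ^+ k = horner_mx B ('X^k %% char_poly B).
  have /(congr1 (horner_mx B)) := divp_eq 'X^k (char_poly B).
  by rewrite rmorphXn rmorphD rmorphM /= horner_mx_X Cayley_Hamilton mulr0 add0r.
set p := _ %% _.
have szp : (size p <= n.+1)%N.
  by rewrite -ltnS -(size_char_poly B) ltn_modp -size_poly_gt0 size_char_poly.
rewrite -[p]coefK poly_def linear_sum mulmx_sumr mulmx_suml big1 // => i _.
rewrite linearZ rmorphXn /= horner_mx_X -scalemxAr -scalemxAl xBG ?scaler0 //.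
exact: leq_trans (ltn_ord i) szp.
Qed.

Section Gramian.
Local Open Scope classical_set_scope.
Variable R : realType.
Variables (n q : nat) (A : 'M[R]_n) (h : R) (G : 'M[R]_(n, q)) (Gd : 'M[R]_n).
Hypothesis h0 : 0 < h.

(* Sampling with step t / 2n puts the first n + 1 sample times in [0, h]; the
   Cayley-Hamilton theorem for the one-step matrix reaches the other ones. *)
Lemma expm_vanish_extend m (x : 'M[R]_(m, n)) :
  (forall t, 0 <= t <= h -> x *m expm A t *m G = 0) ->
  forall t, 0 <= t <= h + h -> x *m expm A t *m G = 0.
Proof.
move=> xG t /andP[t0 t2h].
have [n0|n_gt0] := posnP n.
  by move: x xG => + _; move: A G; rewrite n0 => ? ? ?; rewrite thinmx0 !mul0mx.
pose d := t / (n + n)%:R.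
have tE : t = d *+ (n + n).
  by rewrite -mulr_natr divfK // pnatr_eq0 addn_eq0 andbb -lt0n.
rewrite tE expm_natmul; apply: mulmx_pow_eq0 => k kn.
rewrite -expm_natmul xG //.
have d0 : 0 <= d by rewrite divr_ge0.
rewrite mulrn_wge0 //=; apply: (@le_trans _ _ (d *+ n)).
  by rewrite ler_wpMn2l // ltnW.
have : d *+ n + d *+ n <= h + h by rewrite -mulrnDr -tE.
by lra.
Qed.

Hypothesis Gd_sym : Gd^T = Gd.
Hypothesis GdE :
  Gd *m Gd = mx_integral 0 h (fun tau => expm A tau *m G *m G^T *m expm A^T tau).

Lemma gramian_trace (x : 'rV[R]_n) :
  \tr (x *m Gd *m (x *m Gd)^T) = Rintegral (@lebesgue_measure R) `[0, h]
    (fun t => \tr (x *m expm A t *m G *m (x *m expm A t *m G)^T)).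
Proof.
rewrite trace_mx11 trmx_mul Gd_sym mulmxA -[x *m Gd *m Gd]mulmxA GdE.
rewrite mx_integral_qf; last first.
  apply: mx_continuousM; last by move=> i j; exact: continuous_expm.
  apply: mx_continuousM; last exact: mx_continuous_cst.
  apply: mx_continuousM; last exact: mx_continuous_cst.
  by move=> i j; exact: continuous_expm.
apply: eq_Rintegral => t _.
by rewrite trace_mx11 !trmx_mul expm_tr !mulmxA.
Qed.

(** A zero Gramian form makes [x *m expm A t *m G] vanish on [[0, h]], then on [[0, 2h]]; the second
    half is the integrand for the row [x *m expm A h]. *)
Lemma gramian_ker_expm (x : 'rV[R]_n) : x *m Gd = 0 -> x *m expm A h *m Gd = 0.
Proof.
move=> xGd; apply: gram_trace_eq0; rewrite gramian_trace.
have xG t : 0 <= t <= h -> x *m expm A t *m G = 0.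
  move=> th; apply: gram_trace_eq0; move: t th.
  apply: (@Rintegral_eq0_continuous _ 0 h) => //.
  - under eq_fun do rewrite trace_mx11.
    have cY : mx_continuous (fun t => x *m expm A t *m G).
      apply: mx_continuousM; last exact: mx_continuous_cst.
      apply: mx_continuousM; first exact: mx_continuous_cst.
      by move=> i j; exact: continuous_expm.
    by apply: mx_continuousM => //; exact: mx_continuous_tr.
  - by move=> t; exact: gram_trace_ge0.
  - by rewrite -gramian_trace xGd mul0mx mxtrace0.
rewrite (@eq_Rintegral _ _ _ _ _ (fun=> 0)); first by rewrite Rintegral_cst ?mul0r.
move=> t; rewrite inE /= in_itv /= => /andP[t0 th].
rewrite -[x *m _ *m expm A t]mulmxA -expmD (expm_vanish_extend xG) ?mul0mx ?mxtrace0 //.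
by apply/andP; split; lra.
Qed.

Lemma gramian_sqrt_free : reachable (expm A h) Gd -> row_free Gd.
Proof.
move=> reach; rewrite -kermx_eq0; apply/rowV0P => x /sub_kermxP xGd.
have xk k : x *m expm A h ^+ k *m Gd = 0.
  elim: k => [|k IH]; first by rewrite expr0 mulmx1.
  by rewrite exprSr -mulmxE mulmxA gramian_ker_expm.
(* Reachability is full row rank, so a row killing every block is zero. *)
have free : row_free (\mxrow_(k < n) (expm A h ^+ k *m Gd)) by apply/eqP.
apply/eqP; rewrite -(mulmx_free_eq0 _ free) mul_mxrow; apply/eqP.
rewrite -[RHS](mxrow0 (q_ := fun=> n)); apply: eq_mxrow => k.
by rewrite mulmxA xk.
Qed.
End Gramian.

Theorem theorem1 (R : realType) (n q p r r' : nat) (A : 'M[R]_n) (h : R)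
  (G : 'M[R]_(n, q)) (C : 'M[R]_(p, n)) (H : 'M[R]_p) (s : seq R[i])
  (Ubar : 'M[R]_(n, r)) (Gd : 'M[R]_n) (Rt : 'M[R]_r) :
  0 < h ->
  \det H != 0 ->
  let Ad := expm A h in
  (* Gd is the positive semidefinite square root of the Gramian integral *)
  psd Gd ->
  Gd *m Gd = mx_integral 0 h (fun tau => expm A tau *m G *m G^T *m expm A^T tau) ->
  reachable Ad Gd ->
  observable C Ad ->
  (* s = (lambda_1(A), ..., lambda_n(A)) with multiplicity, Re nonincreasing *)
  eigen_seq A s ->
  re_nonincreasing s ->
  count (fun z => 0 <= complex.Re z) s = r' ->
  (0 < r < n)%N ->
  complex.Re (nth 0 s r) < complex.Re (nth 0 s r.-1) ->
  in_calU A s Ubar ->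
  let M := H *m H^T in
  let AU := Ubar^T *m Ad *m Ubar in
  let GU := Ubar^T *m Gd in
  let CU := C *m Ubar in
  (* Rt is the unique positive definite solution of the reduced DARE *)
  pd Rt ->
  lr_dare AU GU CU M Rt ->
  (forall R' : 'M[R]_r, pd R' -> lr_dare AU GU CU M R' -> R' = Rt) ->
  let Ft := lr_gain CU M Rt in
  schur_stable (Ad *m (1%:M - Ubar *m Ft *m C)) <-> (r' <= r)%N.
Proof.
move=> h0 detH Ad [Gd_sym _] GdE reach _ As s_sorted countE /andP[r0 rn] gap Uc.
move=> M AU GU CU Rt_pd dare _ Ft.
have UTU : Ubar^T *m Ubar = 1%:M by case: Uc.
have [D AUD] := calU_invariant Uc.
have AdU : Ad *m Ubar = Ubar *m AU.
  (* Left multiplication by [Ubar^T] then identifies [expm D h] with [AU]. *)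
  have AdUD : Ad *m Ubar = Ubar *m expm D h by exact/esym/mulmx_expm/esym.
  by rewrite /AU -mulmxA AdUD [Ubar^T *m _]mulmxA UTU mul1mx.
have AAd : A *m Ad = Ad *m A by exact: expm_comm.
have GU_free : row_free GU.
  rewrite /GU /row_free mxrankMfree; last exact: (gramian_sqrt_free h0 Gd_sym GdE).
  by apply/row_freeP; exists Ubar.
have K_schur := lr_closed_loop_schur detH Rt_pd dare GU_free.
have size_s : size s = n.
  have := size_char_poly (cplx_mx A); rewrite As size_prod_XsubC => -[//].
set M' := Ad *m _.
have M'U : M' *m Ubar = Ubar *m (AU *m (1%:M - Ft *m CU)).
  rewrite /M' -mulmxA mulmxBl mul1mx mulmxBr AdU.
  rewrite mulmxBr mulmx1 mulmxBr; congr (_ - _).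
  by rewrite -!mulmxA [LHS]mulmxA AdU -!mulmxA.
have M'_orth (x : 'rV[R[i]]_n) : x *m cplx_mx Ubar = 0 ->
    x *m cplx_mx M' = x *m cplx_mx Ad.
  move=> xU; rewrite /M' mulmxBr mulmx1 cplx_mxB mulmxBr.
  by rewrite !mulmxA AdU !cplx_mxM !mulmxA xU !mul0mx subr0.
(* Indices start at 0, so the gap lies between [r.-1] and [r]; an eigenvalue occurring on both sides
   would close it. *)
have notin_top k : (r <= k)%N -> (k < size s)%N -> forall j, (j < r)%N ->
    nth 0 s k != nth 0 s j.
  move=> rk ks j jr; apply: contraTneq gap => kj; rewrite -leNgt.
  apply: (@le_trans _ _ (complex.Re (nth 0 s j))).
    apply: re_nonincreasing_nth => //; rewrite size_s (leq_ltn_trans (leq_pred r)) //.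
    by rewrite andbT -ltnS prednK.
  by rewrite -kj; apply: re_nonincreasing_nth => //; rewrite rk.
split=> [/schur_stableP stab|r'r].
  (* If [r < r'], the eigenvalue at index [r] has nonnegative real part. Its eigenrow annihilates
     [Ubar], so it gives [M'] an eigenvalue of modulus at least 1. *)
  rewrite leqNgt; apply/negP; rewrite -countE -count_Re_ge0 ?size_s // => Re0.
  have /eigenvalueP[x xA x0] : eigenvalue (cplx_mx A) (nth 0 s r).
    by rewrite eigenvalue_root_char As root_prod_XsubC mem_nth ?size_s.
  have xU : x *m cplx_mx Ubar = 0.
    by apply: (calU_eigenrow_orth Uc xA); apply: notin_top; rewrite ?size_s.
  have [z xAd zE] := eigenrow_expm h xA.
  have := stab z x x0; rewrite M'_orth // => /(_ xAd).
  by rewrite zE expR_lt1; nra.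
apply/schur_stableP => z x x0 xM'.
(* A nonzero [x *m cplx_mx Ubar] is an eigenrow of the reduced closed loop for the same [z]. *)
have [xU|xU] := eqVneq (x *m cplx_mx Ubar) 0; last first.
  move/schur_stableP: K_schur => /(_ z _ xU); apply.
  by rewrite -mulmxA -cplx_mxM -M'U cplx_mxM mulmxA xM' scalemxAl.
(* An eigenrow [x] of [Ad] need not be one of [A], as distinct eigenvalues of [A] may have equal
   exponentials. But [E] is nonzero and stable under [A], so it contains a common eigenrow [v]. *)
pose E := (kermx (cplx_mx Ubar) :&: eigenspace (cplx_mx Ad) z)%MS.
have xE : (x <= E)%MS.
  rewrite sub_capmx; apply/andP; split; first exact/sub_kermxP.
  by apply/eigenspaceP; rewrite -M'_orth.
have E0 : E != 0 by apply: contraNneq x0 => E0; move: xE; rewrite E0 submx0.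
have stE : stablemx E (cplx_mx A).
  rewrite sub_capmx; apply/andP; split.
    apply: submx_trans (submxMr _ (capmxSl _ _)) _.
    by apply/sub_kermxP; rewrite -mulmxA -cplx_mxM AUD cplx_mxM mulmxA mulmx_ker mul0mx.
  apply: submx_trans (submxMr _ (capmxSr _ _)) _.
  apply: comm_mx_stable_eigenspace; rewrite /comm_mx -!cplx_mxM.
  by rewrite AAd.
have [v [mu [v0 vE vA]]] := stablemx_eigenrow E0 stE.
move: vE; rewrite sub_capmx => /andP[/sub_kermxP vU /eigenspaceP vAd].
have [z' vAd' zE] := eigenrow_expm h vA.
have zz' : z = z'.
  move/eqP: vAd'; rewrite vAd -subr_eq0 -scalerBl scalemx_eq0 (negPf v0) orbF subr_eq0.
  by move/eqP.
rewrite zz' zE expR_lt1.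
have : mu \in s.
  rewrite -root_prod_XsubC -As -eigenvalue_root_char.
  by apply/eigenvalueP; exists v.
move=> /(nthP 0)[k ks muE].
have rk : (r <= k)%N.
  rewrite leqNgt; apply/negP => kr.
  by have := calU_orth_eigenvalue Uc As v0 vA vU kr; rewrite muE eqxx.
(* Here [r' <= r <= k], so index [k] lies beyond the unstable prefix. *)
have : ~~ (0 <= complex.Re (nth 0 s k)).
  by rewrite count_Re_ge0 // countE -leqNgt (leq_trans r'r).
rewrite -ltNge muE; nra.
Qed.
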